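(* Let $\mathcal{H}$ be a real Hilbert space and let $f:\mathcal{H}\to\mathbb{R}$ be a convex function of class $\mathcal{C}^1$ whose gradient is Lipschitz continuous on bounded subsets of $\mathcal{H}$ and whose set of minimizers $S=\operatorname{argmin} f$ is nonempty; let $x^*$ be the element of minimum norm of $S$. Let $\varepsilon:[t_0,+\infty[\to\,]0,+\infty[$ be a nonincreasing function of class $\mathcal{C}^1$ with $\lim_{t\to+\infty}\varepsilon(t)=0$, and let $\delta>0$. Let $x:[t_0,+\infty[\to\mathcal{H}$ be a solution trajectory of $$\ddot{x}(t)+\delta\sqrt{\varepsilon(t)}\,\dot{x}(t)+\nabla f(x(t))+\varepsilon(t)x(t)=0 .$$ Assume that there exist $a>1$, $c>1$ and $t_1\ge t_0$ such that for all $t\ge t_1$ $$\frac{d}{dt}\left(\frac{1}{\sqrt{\varepsilon(t)}}\right)\le\min\left(2\lambda-\delta,\ \delta-\frac{a+1}{a}\lambda\right),$$ where $\lambda$ is such that $$\frac{\delta}{2}<\lambda<\frac{a}{a+1}\delta\quad\text{if } 0<\delta\le 2-\frac1c,$$ $$\frac12\left(\delta+\frac1c+\sqrt{\left(\delta+\frac1c\right)^2-4}\right)<\lambda<\frac{a}{a+1}\delta\quad\text{if }\delta>2-\frac1c .$$ Let $E$ be the energy function $$E(t):=\Big(\varphi_t(x(t))-\varphi_t(x_{\varepsilon(t)})\Big)+\frac12\left\|\lambda\sqrt{\varepsilon(t)}\,\big(x(t)-x_{\varepsilon(t)}\big)+\dot{x}(t)\right\|^2 .$$ Then, for all $t\ge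 t_1$, $$E(t)\le\frac{\|x^*\|^2}{2}\,\frac{\displaystyle\int_{t_1}^{t}\left((\lambda c+a)\lambda\frac{\dot\varepsilon^2(s)}{\varepsilon^{3/2}(s)}-\dot\varepsilon(s)\right)\gamma(s)\,ds}{\gamma(t)}+\frac{\gamma(t_1)E(t_1)}{\gamma(t)},$$ where $$\gamma(t)=\exp\left(\int_{t_1}^{t}\mu(s)\,ds\right),\qquad \mu(t)=-\frac{\dot\varepsilon(t)}{2\varepsilon(t)}+(\delta-\lambda)\sqrt{\varepsilon(t)} .$$
   Context: $\mathcal{H}$ carries the scalar product $\langle\cdot,\cdot\rangle$ and the norm $\|x\|^2=\langle x,x\rangle$. For $t\ge t_0$, $\varphi_t:\mathcal{H}\to\mathbb{R}$ is defined by $\varphi_t(y)=f(y)+\frac{\varepsilon(t)}{2}\|y\|^2$, and $x_{\varepsilon(t)}$ is the unique minimizer over $\mathcal{H}$ of the strongly convex function $\varphi_t$. A solution trajectory is a twice continuously differentiable function $x:[t_0,+\infty[\to\mathcal{H}$ satisfying the differential equation for all $t\ge t_0$. *)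

(* Defs.v *)
From HB Require Import structures.
From mathcomp Require Export all_boot all_order all_algebra sesquilinear.
From mathcomp Require Export all_classical all_reals all_analysis.
Export Order.TTheory GRing.Theory Num.Theory.
Export numFieldNormedType.Exports.

Set Implicit Arguments.
Unset Strict Implicit.
Unset Printing Implicit Defensive.

Local Open Scope classical_set_scope.
Local Open Scope ring_scope.

Section CalculusWithin.
Context {R : realType} {V : normedModType R}.
Implicit Types (A : set R) (f : R -> V).

(* Derivative along the points of A: the usual two-sided derivative at interior
   points of an interval, the one-sided derivative at an endpoint.  Values of f
   outside A are irrelevant, so functions on [t0, +oo[ are represented by
   functions on R. *)
Definition diff_quot f (t s : R) : V := (s - t)^-1 *: (f s - f t).

Definition derivable_within A f (t : R) : Prop :=
  cvg (diff_quot f t s @[s --> within A t^']).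

Definition derive_within A f (t : R) : V :=
  lim (diff_quot f t s @[s --> within A t^']).

Definition C1_within A f : Prop :=
  (forall t, A t -> derivable_within A f t) /\
  {within A, continuous (derive_within A f)}.

Definition C2_within A f : Prop :=
  C1_within A f /\ C1_within A (derive_within A f).

End CalculusWithin.

Definition argmin {R : realType} {T : Type} (A : set T) (g : T -> R) : set T :=
  [set y | A y /\ forall z, A z -> g y <= g z].

Section Hilbert.
Context {R : realType} {H : completeNormedModType R}.

(* A completeNormedModType together with a scalar product inducing its norm is
   a real Hilbert space. *)
Definition induces_norm (dot : {dot H for idfun}) : Prop :=
  forall u : H, `|u| ^+ 2 = dot u u.

Definition is_gradient (dot : {dot H for idfun}) (f : H -> R) (g : H -> H) :
    Prop :=
  forall y, differentiable f y /\ forall h, 'd f y h = dot (g y) h.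

(* Tikhonov regularization with parameter e; the function called phi_t is
   tikhonov f (eps t). *)
Definition tikhonov (f : H -> R) (e : R) (y : H) : R :=
  f y + e / 2 * `|y| ^+ 2.

Definition trajectory (t0 delta : R) (eps : R -> R) (gradf : H -> H)
    (x : R -> H) : Prop :=
  let D := `[t0, +oo[%classic in
  C2_within D x /\
  forall t, t0 <= t ->
    derive_within D (derive_within D x) t
      + (delta * Num.sqrt (eps t)) *: derive_within D x t
      + gradf (x t) + eps t *: x t = 0.

Definition energy (t0 lambda : R) (f : H -> R) (eps : R -> R) (xeps x : R -> H)
    (t : R) : R :=
  (tikhonov f (eps t) (x t) - tikhonov f (eps t) (xeps t))
  + 2^-1 * `| (lambda * Num.sqrt (eps t)) *: (x t - xeps t)
              + derive_within `[t0, +oo[%classic x t | ^+ 2.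

End Hilbert.

Section Weights.
Context {R : realType}.
Variables (t0 t1 delta lambda : R) (eps : R -> R).

Definition mu (t : R) : R :=
  - derive_within `[t0, +oo[%classic eps t / (2 * eps t)
  + (delta - lambda) * Num.sqrt (eps t).

Definition gamma (t : R) : R :=
  expR (\int[lebesgue_measure]_(s in `[t1, t]) mu s).

End Weights.

(* Main.v *)
Require Import Defs.
From mathcomp Require Import all_boot all_order all_algebra sesquilinear.
From mathcomp Require Import all_classical all_reals all_analysis.
From mathcomp Require Import ring lra.

Set Implicit Arguments.
Unset Strict Implicit.
Unset Printing Implicit Defensive.
Local Open Scope classical_set_scope.
Local Open Scope ring_scope.

(** The inequality says that [gamma E] minus the weighted integral is
   nonincreasing.  Since [x_eps] is only known to be Lipschitz in [eps], [E] is
   not differentiated; its upper right Dini derivative is bounded instead.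
   - [|x_eps| <= |x*|] and, by monotonicity of the gradient,
     [|x_eps(s) - x_eps(t)| <= |eps s - eps t| |x*| / eps t]: this controls every
     occurrence of the increment of [x_eps] in the kinetic part of [E].
   - [phi_t(x_eps(t)) <= phi_t(x_eps(s))] bounds the increment of the minimal
     value, and convexity bounds that of [f (x t)].
   - In the resulting bound for [E' + mu E] the products [<x - x_eps, x'>] cancel;
     two weighted AM-GM inequalities (with weights [a] and [c]) absorb the norm of
     the derivative of [x_eps], and strong convexity of [phi_t] with the growth
     condition on [1 / sqrt eps] and the choice of [lambda] makes all remaining
     terms nonpositive. *)

(** * Algebra and continuity of the scalar product *)

Section InnerProduct.
Context {R : realType} {H : completeNormedModType R}.
Variables (dot : {dot H for idfun}) (dot_norm : induces_norm dot).
Implicit Types u v w : H.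

Lemma dotC u v : dot u v = dot v u.
Proof. by rewrite hermC expr0 mul1r. Qed.

Lemma dotDl u v w : dot (u + v) w = dot u w + dot v w.
Proof. exact: linearDl. Qed.

Lemma dotNl u w : dot (- u) w = - dot u w.
Proof. exact: linearNl. Qed.

Lemma dotZl (k : R) u w : dot (k *: u) w = k * dot u w.
Proof. exact: linearZl_LR. Qed.

Lemma dotDr u v w : dot w (u + v) = dot w u + dot w v.
Proof. by rewrite dotC dotDl !(dotC w). Qed.

Lemma dotNr u w : dot w (- u) = - dot w u.
Proof. by rewrite dotC dotNl (dotC w). Qed.

Lemma dotZr (k : R) u w : dot w (k *: u) = k * dot w u.
Proof. by rewrite dotC dotZl (dotC w). Qed.

Definition dotE := (dotDl, dotDr, dotNl, dotNr, dotZl, dotZr).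

Lemma dot_sqr_normD u v : `|u + v| ^+ 2 = `|u| ^+ 2 + 2 * dot u v + `|v| ^+ 2.
Proof. rewrite !dot_norm !dotE (dotC v u); ring. Qed.

Lemma dot_polar u v : dot u v = 4^-1 * (`|u + v| ^+ 2 - `|u - v| ^+ 2).
Proof. rewrite !dot_norm !dotE (dotC v u); lra. Qed.

Lemma dot_le_norm u v : dot u v <= `|u| * `|v|.
Proof.
have : `|u + v| ^+ 2 <= (`|u| + `|v|) ^+ 2.
  by rewrite lerXn2r ?nnegrE ?addr_ge0 ?ler_normD.
by rewrite dot_sqr_normD sqrrD mulr2n => h; lra.
Qed.

Lemma dot_ge_norm u v : - (`|u| * `|v|) <= dot u v.
Proof. by rewrite lerNl -dotNl (le_trans (dot_le_norm _ _))// normrN. Qed.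

(** Polarization expresses the product through norms alone, so it inherits the continuity of the
    norm. *)
Lemma cvg_dot (T : Type) (F : set_system T) (FF : Filter F) (g h : T -> H) u v :
  g z @[z --> F] --> u -> h z @[z --> F] --> v ->
  dot (g z) (h z) @[z --> F] --> dot u v.
Proof.
move=> gu hv.
under eq_fun do rewrite dot_polar.
rewrite dot_polar; apply: cvgMr.
have cvg_sqr_norm (k : T -> H) w : k z @[z --> F] --> w ->
    `|k z| ^+ 2 @[z --> F] --> `|w| ^+ 2.
  by move=> kw; apply: cvgM; apply: cvg_norm.
by apply: cvgB; apply: cvg_sqr_norm; [exact: cvgD|exact: cvgB].
Qed.

(** Here [h] is a time step, [h *: w] a controlled increment of [v], and [y] a perturbation known
    only through a bound of order [h]. Cauchy-Schwarz handles the product of [v] and [y]; what is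
    quadratic in the increments keeps a spare factor [h] and will vanish in the limit. *)
Lemma half_sqr_norm_increment (h k n q : R) (v w y : H) :
  0 <= h -> 0 <= k -> `|v| <= n -> `|y| <= h * q ->
  2^-1 * `|v + (h *: w - k *: y)| ^+ 2 <= 2^-1 * `|v| ^+ 2
    + h * (dot v w + k * n * q + h / 2 * (`|w| + k * q) ^+ 2).
Proof.
move=> h0 k0 vn yq.
rewrite dot_sqr_normD !dotE.
have n0 : 0 <= n by exact: le_trans vn.
have vy : - dot v y <= n * (h * q).
  rewrite -dotNr (le_trans (dot_le_norm _ _))// normrN.
  by rewrite ler_pM.
have : `|h *: w - k *: y| <= h * (`|w| + k * q).
  rewrite (le_trans (ler_normB _ _))// !normrZ !ger0_norm//.
  by rewrite mulrDr lerD2l mulrCA ler_wpM2l.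
move=> /(lerXn2r 2); rewrite !nnegrE => /(_ (normr_ge0 _)).
have hwq : 0 <= h * (`|w| + k * q).
  rewrite mulrDr addr_ge0//; first exact: mulr_ge0.
  by rewrite mulrCA mulr_ge0// (le_trans _ yq).
move=> /(_ hwq) sq.
have := ler_wpM2l k0 vy.
move=> kvy; lra.
Qed.

(** A discrete product rule for [b *: (x - p) + u] that isolates the increment of [p], the only one
    not treated by differentiation. *)
Lemma velocity_increment (b c : R) (x1 p1 u1 x2 p2 u2 : H) :
  c *: (x1 - p1) + u1
    + ((b - c) *: (x1 - p1) + b *: (x2 - x1) + (u2 - u1) - b *: (p2 - p1))
  = b *: (x2 - p2) + u2.
Proof.
rewrite [X in _ + X]addrAC addrACA [u1 + _]addrC (subrK u1); congr (_ + u2).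
rewrite !addrA -scalerDl [c + _]addrC (subrK c) -scalerDr -scalerBr.
congr (_ *: _).
by rewrite opprB [x1 - p1 + _]addrC !addrA (subrK x1) (subrK p1).
Qed.

End InnerProduct.

(** * First-order inequality for convex functions *)

Section ConvexGradient.
Context {R : realType} {H : completeNormedModType R}.
Variables (dot : {dot H for idfun}) (dot_norm : induces_norm dot).
Variables (f : H -> R) (gradf : H -> H).
Hypotheses (f_grad : is_gradient dot f gradf).

Lemma gradient_cvg (y h : H) :
  s^-1 * (f (y + s *: h) - f y) @[s --> 0^'+] --> dot (gradf y) h.
Proof.
have [df dfE] := f_grad y.
rewrite -dfE -deriveE//.
apply: cvg_dnbhs_at_right.
rewrite /derive.
have := @diff_derivable _ _ _ f y h df; rewrite /derivable.
move=> /cvg_ex[l fl].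
rewrite (cvg_lim _ fl)//.
suff -> : (fun s => s^-1 * (f (y + s *: h) - f y)) =
  fun s => s^-1 *: ((f \o shift y) (s *: h) - f y) by [].
by apply/funext => s; rewrite (addrC y).
Qed.

(** On the segment from [y] to [z], convexity bounds every difference quotient with step in []0, 1]]
    by [f z - f y]; the bound survives in the limit. *)
Lemma convex_gradient_le (f_convex : convex_function setT f) (y z : H) :
  f y + dot (gradf y) (z - y) <= f z.
Proof.
rewrite -lerBrDl.
have := gradient_cvg (y := y) (h := z - y).
move/cvgr_to_le; apply.
near=> s.
have s0 : 0 < s by near: s; exact: nbhs_right_gt.
have s1 : s <= 1 by near: s; apply: nbhs_right_le.
rewrite ler_pdivrMl//.
have := f_convex (Itv01 (ltW s0) s1)  z y
  (in_setT _) (in_setT _).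
move=> h.
have : f (s *: z + (1 - s) *: y) <= s * f z + (1 - s) * f y by exact: h.
rewrite (_ : s *: z + (1 - s) *: y = y + s *: (z - y)).
  by move=> ?; lra.
by rewrite scalerBr scalerBl scale1r addrCA.
Unshelve. all: by end_near. Qed.

End ConvexGradient.

(** * Minimizers of the regularized function *)

Section TikhonovMinimizer.
Context {R : realType} {H : completeNormedModType R}.
Variables (dot : {dot H for idfun}) (dot_norm : induces_norm dot).
Variables (f : H -> R) (gradf : H -> H).
Hypotheses (f_grad : is_gradient dot f gradf).
Hypotheses (f_convex : convex_function setT f).

Lemma tikhonov_argmin_gradient (e : R) (p : H) :
  argmin setT (tikhonov f e) p -> gradf p = - (e *: p).
Proof.
move=> [_ pmin].
have dge0 h : 0 <= dot (gradf p) h + e * dot p h.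
  (* Before the limit, the sum is the difference quotient at [p] along [h] of the regularized
     function, nonnegative by minimality; its last term tends to 0. *)
  have lim_h : s^-1 * (f (p + s *: h) - f p) + (e * dot p h)
      + s * (e / 2 * `|h| ^+ 2) @[s --> 0^'+] -->
      dot (gradf p) h + e * dot p h + 0 * (e / 2 * `|h| ^+ 2).
    apply: cvgD; last first.
      by apply: cvgMl; apply: cvg_at_right_filter; exact: cvg_id.
    by apply: cvgD; [exact: gradient_cvg|exact: cvg_cst].
  rewrite mul0r addr0 in lim_h.
  apply: (cvgr_to_ge lim_h); near=> s.
  have s0 : 0 < s by near: s; exact: nbhs_right_gt.
  have := pmin (p + s *: h) I; rewrite /tikhonov (dot_sqr_normD dot_norm) dotZr normrZ.
  rewrite exprMn real_normK ?num_real// => le_s.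
  by rewrite -(pmulr_rge0 _ s0) 2!mulrDr mulVKf ?gt_eqF//; lra.
apply/eqP; rewrite -subr_eq0 opprK -normr_eq0 -sqrf_eq0 eq_le sqr_ge0 andbT.
rewrite dot_norm {1}dotDl dotZl.
(* In this direction the directional derivative is minus the squared norm of the full gradient. *)
have := dge0 (- (gradf p + e *: p)).
by rewrite !dotNr mulrN -opprD oppr_ge0.
Unshelve. all: by end_near. Qed.

(** The first-order inequality for [f] at [x], plus an exact expansion of the quadratic part, which
    produces the term in [|x - p|^2]. *)
Lemma tikhonov_strongly_convex (e : R) (x p : H) :
  tikhonov f e x - tikhonov f e p + e / 2 * `|x - p| ^+ 2
  <= dot (x - p) (gradf x + e *: x).
Proof.
have := convex_gradient_le f_grad f_convex x p.
rewrite /tikhonov (dot_sqr_normD dot_norm x (- p)) !dot_norm !dotE.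
rewrite (dotC _ (gradf x) x) (dotC _ (gradf x) p) (dotC _ p x).
lra.
Qed.

(** Adding the first-order inequalities between [p1] and [p2] gives monotonicity of the gradient.
    With the optimality conditions this reads [e1 |p1 - p2|^2 <= (e2 - e1) <p2, p1 - p2>];
    Cauchy-Schwarz and division by [|p1 - p2|] conclude. *)
Lemma tikhonov_argmin_lipschitz (e1 e2 : R) (p1 p2 : H) : 0 <= e1 ->
  argmin setT (tikhonov f e1) p1 -> argmin setT (tikhonov f e2) p2 ->
  e1 * `|p1 - p2| <= `|e2 - e1| * `|p2|.
Proof.
move=> e1_ge0 /tikhonov_argmin_gradient g1 /tikhonov_argmin_gradient g2.
have := convex_gradient_le f_grad f_convex p1 p2.
have := convex_gradient_le f_grad f_convex p2 p1.
rewrite g1 g2 => h1 h2.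
have [->|p12] := eqVneq p1 p2; first by rewrite subrr normr0 mulr0 mulr_ge0.
rewrite -(ler_pM2r (_ : 0 < `|p1 - p2|)) ?normr_gt0 ?subr_eq0//.
have -> : e1 * `|p1 - p2| * `|p1 - p2| = e1 * `|p1 - p2| ^+ 2 by ring.
apply: (@le_trans _ _ ((e2 - e1) * dot p2 (p1 - p2))).
  move: h1 h2; rewrite dot_norm !dotE (dotC _ p2 p1) => h1 h2.
  by nra.
rewrite -mulrA (le_trans (ler_norm _))// normrM ler_wpM2l//.
by rewrite ler_norml dot_ge_norm ?dot_le_norm.
Qed.

(** Since [f xstar <= f p], the point [p] can win the regularized comparison only through a smaller
    norm. *)
Lemma tikhonov_argmin_norm (e : R) (p xstar : H) : 0 < e ->
  argmin setT f xstar -> argmin setT (tikhonov f e) p -> `|p| <= `|xstar|.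
Proof.
move=> e0 [_ /(_ p I) fx] [_ /(_ xstar I)]; rewrite /tikhonov => le_p.
rewrite -(@ler_pXn2r _ 2)// ?nnegrE// -(@ler_pM2l _ (e / 2)) ?divr_gt0//; lra.
Qed.

End TikhonovMinimizer.

(** * Right derivatives and monotonicity from a Dini bound *)

Section RightCalculus.
Context {R : realType} {V : normedModType R}.

(** If [F] increased overall, a slightly tilted [G] would still cross a level [y] between its end
    values. At the last point [tau] where [G] is at most [y], the Dini bound keeps [G] below [y] a
    little further, a contradiction. *)
Lemma nonincreasing_right_dini (F : R -> R) (a b : R) : a <= b ->
  {within `[a, b], continuous F} ->
  (forall t, a < t -> t < b -> forall e, 0 < e ->
     \forall s \near t^'+, F s <= F t + e * (s - t)) ->
  F b <= F a.
Proof.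
rewrite le_eqVlt => /predU1P[->//|ab] /subspace_continuousP cF dF.
rewrite leNgt; apply/negP => FaFb.
(* Half of the mean slope: the tilt leaves [G b - G a = (F b - F a) / 2], and [y] is the midpoint of
   [G a] and [G b]. *)
pose e := (F b - F a) / (2 * (b - a)).
have ba0 : 0 < b - a by rewrite subr_gt0.
have e0 : 0 < e by rewrite divr_gt0 ?subr_gt0// mulr_gt0.
pose G t := F t - e * (t - a).
pose y := F a + (F b - F a) / 4.
have Gay : G a < y by rewrite /G /y subrr mulr0; lra.
have Gby : y < G b.
  have -> : G b = F a + (F b - F a) / 2 by rewrite /G /e; field; rewrite gt_eqF.
  rewrite /y; lra.
have cG t : a <= t <= b -> G s @[s --> within `[a, b] (nbhs t)] --> G t.
  move=> tab; apply: cvgB; first by apply: cF; rewrite /= in_itv.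
  apply: cvgMr; apply: cvgB; last exact: cvg_cst.
  by apply: cvg_within_filter; exact: cvg_id.
pose A := [set t | a <= t <= b /\ G t <= y].
have Aa : A a by split; [rewrite lexx ltW|exact: ltW].
have supA : has_sup A.
  by split; [exists a|exists b => t [/andP[]]].
pose tau := sup A.
have atau : a <= tau by apply: ub_le_sup => //; case: supA.
have taub : tau <= b by apply: ge_sup; [exists a|move=> t [/andP[]]].
have tauab : a <= tau <= b by rewrite atau taub.
have Gtau : G tau <= y.
  rewrite leNgt; apply/negP => yG.
  have := cvgr_gt _ (cG _ tauab) _ yG.
  rewrite near_withinE => -[d /= d0 dG].
  have [t At tt] := sup_adherent d0 supA.
  have ttau : t <= tau by apply: ub_le_sup => //; case: supA.
  have [tab Gt] := At.
  suff : y < G t by rewrite ltNge Gt.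
  apply: dG; last by rewrite /= in_itv.
  by rewrite /= ger0_norm ?subr_ge0// ltrBlDr addrC -ltrBlDr.
have tau_lt_b : tau < b.
  rewrite lt_neqAle taub andbT; apply/eqP => taubE.
  by move: Gtau; rewrite taubE leNgt Gby.
(* The Dini bound is given at interior points only; [G a < y] is strict, so continuity pushes [tau]
   off the endpoint. *)
have a_lt_tau : a < tau.
  rewrite lt_neqAle atau andbT; apply/eqP => atauE.
  have aab : a <= a <= b by rewrite lexx ltW.
  have := cvgr_lt _ (cG _ aab) _ Gay.
  rewrite near_withinE => -[d /= d0 dG].
  pose t := Num.min (a + d / 2) b.
  have at_ : a < t by rewrite lt_min ab andbT ltrDl divr_gt0.
  have tab : a <= t <= b by rewrite ltW//= ge_min lexx orbT.
  have : A t.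
    split=> //; apply/ltW/dG; last by rewrite /= in_itv.
    rewrite /= ltr0_norm ?subr_lt0// opprB ltrBlDl.
    have : t <= a + d / 2 by rewrite ge_min lexx.
    by move=> ?; lra.
  by move=> /(ub_le_sup supA.2); rewrite -/tau -atauE leNgt at_.
have [d /= d0 dG] := dF _ a_lt_tau tau_lt_b _ e0.
pose t := Num.min (tau + d / 2) b.
have taut : tau < t by rewrite lt_min tau_lt_b andbT ltrDl divr_gt0.
have tab : a <= t <= b.
  by rewrite (ltW (lt_trans a_lt_tau taut))/= ge_min lexx orbT.
have : A t.
  split=> //; apply: le_trans Gtau; rewrite /G.
  suff: F t <= F tau + e * (t - tau) by move=> ?; lra.
  apply: dG => //=.
  rewrite ltr0_norm ?subr_lt0// opprB ltrBlDl.
  have : t <= tau + d / 2 by rewrite ge_min lexx.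
    by move=> ?; lra.
by move=> /(ub_le_sup supA.2); rewrite -/tau leNgt taut.
Qed.

Lemma at_right_within (t0 t : R) : t0 <= t ->
  t^'+ `=>` within `[t0, +oo[ t^'.
Proof.
move=> t0t P; rewrite /nbhs/= => -[d d0 dP]; exists d => //= s /= ds ts.
by apply: dP => //=; rewrite ?in_itv/= ?gt_eqF ?andbT// (le_trans t0t)// ltW.
Qed.

Lemma derive_within_right (t0 t : R) (g : R -> V) : t0 <= t ->
  derivable_within `[t0, +oo[ g t ->
  diff_quot g t s @[s --> t^'+] --> derive_within `[t0, +oo[ g t.
Proof.
move=> t0t dg; apply: cvg_trans dg; apply: cvg_app.
exact: at_right_within.
Qed.

Lemma derivable_within_continuous (t0 t : R) (g : R -> V) : t0 <= t ->
  derivable_within `[t0, +oo[ g t ->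
  g s @[s --> within `[t0, +oo[ (nbhs t)] --> g t.
Proof.
move=> t0t /cvg_ex[l dg].
(* Off [t] this expression equals [g s]; the point [s = t], absent from the punctured filter, is
   added separately below. *)
have : g t + (s - t) *: diff_quot g t s @[s --> within `[t0, +oo[ t^'] -->
    g t + (t - t) *: l.
  apply: cvgD; first exact: cvg_cst.
  apply: cvgZ => //; apply: cvgB; last exact: cvg_cst.
  apply: cvg_within_filter; apply: cvg_within_filter; exact: cvg_id.
rewrite subrr scale0r addr0 => /cvgrPdist_lt cg.
apply/cvgrPdist_lt => e e0; have := cg e e0.
rewrite /dnbhs !near_withinE => cge; near=> s => Ds.
have [->|st] := eqVneq s t; first by rewrite subrr normr0.
suff <- : g t + (s - t) *: diff_quot g t s = g s.
  by move: st Ds; near: s.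
by rewrite /diff_quot scalerA divff ?subr_eq0// scale1r addrC subrK.
Unshelve. all: by end_near. Qed.

Lemma at_right_within_nbhs (t0 t : R) : t0 <= t ->
  t^'+ `=>` within `[t0, +oo[ (nbhs t).
Proof.
move=> t0t P wP; apply: (at_right_within t0t).
exact: (@cvg_within _ (nbhs t)).
Qed.

Lemma derivable_within_right_continuous (t0 t : R) (g : R -> V) : t0 <= t ->
  derivable_within `[t0, +oo[ g t -> g s @[s --> t^'+] --> g t.
Proof.
move=> t0t /(derivable_within_continuous t0t).
by apply: cvg_trans; apply: cvg_app; exact: at_right_within_nbhs.
Qed.

Lemma derivable_right (F : R -> R) (t : R) : derivable F t 1 ->
  diff_quot F t s @[s --> t^'+] --> derive1 F t.
Proof.
rewrite derive1E /derive => dF.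
apply: cvg_dnbhs_at_right.
have -> : diff_quot F t =
    (fun h => h^-1 *: ((F \o shift t) (h *: 1) - F t)) \o (fun s => s - t).
  by apply/funext => s; rewrite /diff_quot /= /GRing.scale/= mulr1 subrK.
apply: cvg_comp dF.
move=> P; rewrite /nbhs/= => -[d d0 dP]; exists d => //= s /= ds st.
apply: dP; last by rewrite subr_eq0.
by rewrite /= sub0r opprB.
Qed.

End RightCalculus.

(** * Integrals of continuous functions on a half-line *)

Section IntegralHalfLine.
Context {R : realType}.
Variables (a : R) (g : R -> R).
Hypothesis cg : {within `[a, +oo[, continuous g}.

Lemma halfline_continuous_at (t : R) : a < t -> {for t, continuous g}.
Proof.
move=> at_; have [cg' _] := (continuous_within_itvcyP a g).1 cg.
by apply: cg'; rewrite in_itv/= at_.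
Qed.

Lemma halfline_integrable (b : R) :
  (@lebesgue_measure R).-integrable `[a, b] (EFin \o g).
Proof.
apply: continuous_compact_integrable; first exact: segment_compact.
apply: continuous_subspaceW cg => s /=.
by rewrite !in_itv/= => /andP[->].
Qed.

Lemma halfline_FTC (t : R) : a < t ->
  let G s := \int[lebesgue_measure]_(r in `[a, s]) g r in
  derivable G t 1 /\ derive1 G t = g t.
Proof.
(* The right end [t + 1] makes [t] interior to the interval of integration. *)
move=> at_ G; apply: (@continuous_FTC1_closed _ _ _ _ (t + 1)) => //.
- by rewrite ltrDl.
- exact: halfline_integrable.
- exact: halfline_continuous_at.
Qed.

Lemma halfline_integral_continuous :
  {within `[a, +oo[,
    continuous (fun t => \int[lebesgue_measure]_(r in `[a, t]) g r)}.
Proof.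
apply/continuous_within_itvcyP; split.
  move=> t; rewrite in_itv/= andbT => at_.
  apply: differentiable_continuous; apply/derivable1_diffP.
  by have [] := halfline_FTC at_.
have a1 : a < a + 1 by rewrite ltrDl.
have := parameterized_integral_continuous (ltW a1) (halfline_integrable (a + 1)).
by move=> /(continuous_within_itvP _ a1)[].
Qed.

End IntegralHalfLine.

(** * Derivative of the inverse square root of [eps] *)

Section DeriveWithin.
Context {R : realType}.
Variables (t0 t : R) (t0_le_t : t0 <= t) (eps : R -> R).
Hypothesis eps_gt0 : forall s, t0 <= s -> 0 < eps s.
Hypothesis eps_der : derivable_within `[t0, +oo[ eps t.

Lemma sqrt_within_continuous :
  Num.sqrt (eps s) @[s --> within `[t0, +oo[ (nbhs t)] --> Num.sqrt (eps t).
Proof.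
apply: continuous_cvg; first exact: sqrt_continuous.
exact: derivable_within_continuous.
Qed.

(** Turns the growth condition into one on the derivative of [eps], by factoring [eps s - eps t] as
    a difference of squares of the square roots. *)
Lemma derive_within_inv_sqrt :
  derive_within `[t0, +oo[ (fun s => 1 / Num.sqrt (eps s)) t =
  - derive_within `[t0, +oo[ eps t / (2 * eps t * Num.sqrt (eps t)).
Proof.
have st0 := sqrtr_gt0 (eps t); rewrite eps_gt0// in st0.
set l := derive_within _ eps t.
(* Uniqueness of the limit needs a proper filter; it is coarser than the right neighbourhoods of
   [t], which are proper. *)
have FF : ProperFilter (within `[t0, +oo[ t^').
  split; last exact: within_filter.
  by move=> /(at_right_within t0_le_t); apply: filter_not_empty.
have de : diff_quot eps t s @[s --> within `[t0, +oo[ t^'] --> l by exact: eps_der.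
apply: cvg_lim => //.
have cs : Num.sqrt (eps s) @[s --> within `[t0, +oo[ t^'] --> Num.sqrt (eps t).
  apply: cvg_trans sqrt_within_continuous; apply: cvg_app.
  by move=> P; apply: (@cvg_within _ (nbhs t)).
have -> : - l / (2 * eps t * Num.sqrt (eps t)) =
    - l * (Num.sqrt (eps t) * Num.sqrt (eps t)
           * (Num.sqrt (eps t) + Num.sqrt (eps t)))^-1.
  congr (_ * _^-1); rewrite -{1}(sqr_sqrtr (ltW (eps_gt0 t0_le_t))); ring.
have : - diff_quot eps t s * (Num.sqrt (eps s) * Num.sqrt (eps t)
          * (Num.sqrt (eps s) + Num.sqrt (eps t)))^-1
    @[s --> within `[t0, +oo[ t^'] -->
    - l * (Num.sqrt (eps t) * Num.sqrt (eps t)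
           * (Num.sqrt (eps t) + Num.sqrt (eps t)))^-1.
  apply: cvgM; first exact: cvgN.
  apply: cvgV; first by rewrite gt_eqF// !mulr_gt0// addr_gt0.
  apply: cvgM; first by apply: cvgMl.
  by apply: cvgD => //; exact: cvg_cst.
apply: cvg_trans; apply: near_eq_cvg; rewrite near_withinE.
near=> s => Ds.
have Ds' : t0 <= s by move: Ds; rewrite /= in_itv/= andbT.
have ss0 := sqrtr_gt0 (eps s); rewrite eps_gt0// in ss0.
rewrite /diff_quot /GRing.scale/=.
rewrite -{1}(sqr_sqrtr (ltW (eps_gt0 Ds'))).
rewrite -{1}(sqr_sqrtr (ltW (eps_gt0 t0_le_t))).
have st : s != t by near: s; exact: nbhs_dnbhs_neq.
field.
by apply/and4P; split; rewrite ?subr_eq0// gt_eqF// addr_gt0.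
Unshelve. all: by end_near. Qed.

End DeriveWithin.

(** * Scalar inequalities behind the decay rate *)

Section EnergyAlgebra.
Context {R : realType}.

(** For small [delta] the quadratic is [(lambda - 1)^2 + (2 - delta - 1/c) lambda], a sum of
    nonnegative terms; for large [delta], [lambda] lies beyond its larger root. *)
Lemma damping_quadratic_ge0 (delta c lambda : R) : 0 < delta -> 1 < c ->
  (delta <= 2 - 1 / c -> delta / 2 < lambda) ->
  (2 - 1 / c < delta ->
     2^-1 * (delta + 1 / c + Num.sqrt ((delta + 1 / c) ^+ 2 - 4)) < lambda) ->
  0 < lambda /\ 0 <= lambda ^+ 2 - (delta + 1 / c) * lambda + 1.
Proof.
move=> delta0 c1 small large.
have c0 : 0 < 1 / c by rewrite divr_gt0// (lt_trans _ c1).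
have [dc|dc] := lerP delta (2 - 1 / c).
  have l0 : 0 < lambda by rewrite (lt_trans _ (small dc))// divr_gt0.
  split=> //; have := sqr_ge0 (lambda - 1).
  have : 0 <= (2 - (delta + 1 / c)) * lambda by rewrite mulr_ge0 ?(ltW l0)//; lra.
  by move=> ? ?; lra.
have := large dc; set s := Num.sqrt _ => ls.
have s0 : 0 <= s by exact: sqrtr_ge0.
have sE : s ^+ 2 = (delta + 1 / c) ^+ 2 - 4 by rewrite sqr_sqrtr//; nra.
split; first lra.
have : s ^+ 2 <= (2 * lambda - (delta + 1 / c)) ^+ 2.
  by rewrite ler_sqr ?nnegrE//; lra.
by rewrite sE => ?; lra.
Qed.

(* [d] stands for the derivative of [1 / sqrt eps] and [r] for [sqrt eps], so
   that [eps' = - 2 d r^3]; [A], [B], [X], [G] are the squared norms of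
   [x - x_eps] and [x'], their product, and the product of [x - x_eps] with the
   gradient of the regularized function. *)
Lemma energy_rate_algebra (delta lambda a c r d W A B X G K : R) :
  0 < a -> 0 < c -> 0 < lambda -> 0 < r -> 0 <= d -> 0 <= W -> 0 <= A -> 0 <= B ->
  0 <= lambda ^+ 2 - (delta + 1 / c) * lambda + 1 ->
  d <= 2 * lambda - delta -> d <= delta - (a + 1) / a * lambda ->
  W + r ^+ 2 / 2 * A <= G ->
  - (lambda ^+ 2 * d * r ^+ 3 * A) + lambda * (lambda - delta) * r ^+ 2 * X
   - lambda * r * G - lambda * d * r ^+ 2 * X + (lambda - delta) * r * B
   + lambda * r * (lambda * r * Num.sqrt A + Num.sqrt B) * (2 * d * r * K)
   + r * (d + delta - lambda)
     * (W + 2^-1 * (lambda ^+ 2 * r ^+ 2 * A + 2 * (lambda * r * X) + B))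
  <= 2 * (lambda * c + a) * lambda * d ^+ 2 * r ^+ 3 * K ^+ 2.
Proof.
move=> a0 c0 l0 r0 d0 W0 A0 B0 quad d1 d2 GW.
have [ge0l ge0r] := (ltW l0, ltW r0).
set al := Num.sqrt A; set be := Num.sqrt B.
have alE : al ^+ 2 = A by rewrite sqr_sqrtr.
have beE : be ^+ 2 = B by rewrite sqr_sqrtr.
have amgm_be : 0 <= lambda * r *
    (be ^+ 2 * a^-1 / 2 + 2 * a * d ^+ 2 * r ^+ 2 * K ^+ 2 - 2 * d * r * K * be).
  rewrite [leRHS](_ : _ = lambda * r * a^-1 / 2 * (be - 2 * a * d * r * K) ^+ 2).
    by rewrite mulr_ge0 ?sqr_ge0// !mulr_ge0// invr_ge0 ltW.
  by field; rewrite gt_eqF.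
have amgm_al : 0 <= lambda ^+ 2 * r ^+ 3 *
    (al ^+ 2 * c^-1 / 2 + 2 * c * d ^+ 2 * K ^+ 2 - 2 * d * K * al).
  rewrite [leRHS](_ : _ = lambda ^+ 2 * r ^+ 3 * c^-1 / 2 * (al - 2 * c * d * K) ^+ 2).
    by rewrite mulr_ge0 ?sqr_ge0// !mulr_ge0 ?exprn_ge0// invr_ge0 ltW.
  by field; rewrite gt_eqF.
(* The terms in [X] cancel. Once [G] is replaced by its lower bound and the two squares above are
   used, the coefficients of [W], [B] and [A] are the opposites of those in [W_term], [be_term] and
   [al_term]: the growth bounds sign the first two, the quadratic in [lambda] the third. *)
have W_term : 0 <= r * (2 * lambda - delta - d) * W.
  by rewrite !mulr_ge0// subr_ge0.
have be_term : 0 <= r / 2 * (delta - lambda - lambda * a^-1 - d) * B.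
  have aE : (a + 1) / a * lambda = lambda + lambda * a^-1.
    by field; rewrite gt_eqF.
  by rewrite aE in d2; rewrite !mulr_ge0 ?sqr_ge0//; lra.
have al_term : 0 <= lambda * r ^+ 3 / 2 *
    (lambda ^+ 2 - (delta + c^-1) * lambda + 1 + lambda * d) * A.
  apply: mulr_ge0 => //; apply: mulr_ge0; first by rewrite !mulr_ge0 ?exprn_ge0.
  by rewrite addr_ge0 ?mulr_ge0//; rewrite div1r in quad.
have G_term : 0 <= lambda * r * (G - W - r ^+ 2 / 2 * A).
  by rewrite !mulr_ge0//; lra.
rewrite alE in amgm_al; rewrite beE in amgm_be; lra.
Qed.

End EnergyAlgebra.

(** * Increments and right slope of the energy along a trajectory *)

Section TikhonovEnergy.
Context {R : realType} {H : completeNormedModType R}.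
Variables (dot : {dot H for idfun}) (dot_norm : induces_norm dot).
Variables (f : H -> R) (gradf : H -> H).
Hypotheses (f_convex : convex_function setT f) (f_grad : is_gradient dot f gradf).
Variables (xstar : H) (xstar_min : argmin setT f xstar).

(** Index 2 is the later time. Testing the minimality of [p1] at [p2] costs
    [(e1 - e2) / 2 * |p2|^2], and [|p2| <= |xstar|]; convexity is used at [x2], which gives an upper
    bound on [f x2 - f x1]. *)
Lemma tikhonov_gap_increment (e1 e2 : R) (p1 p2 x1 x2 : H) : 0 < e2 -> e2 <= e1 ->
  argmin setT (tikhonov f e1) p1 -> argmin setT (tikhonov f e2) p2 ->
  (tikhonov f e2 x2 - tikhonov f e2 p2) - (tikhonov f e1 x1 - tikhonov f e1 p1)
  <= dot (gradf x2) (x2 - x1)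
     + 2^-1 * (e2 * dot (x2 + x1) (x2 - x1) + (e2 - e1) * `|x1| ^+ 2)
     - 2^-1 * ((e2 - e1) * `|xstar| ^+ 2).
Proof.
move=> e2_gt0 e21 [_ /(_ p2 I) p1min] p2min.
have p2x := tikhonov_argmin_norm e2_gt0 xstar_min p2min.
have fx := convex_gradient_le f_grad f_convex x2 x1.
have p2sq : (e1 - e2) * `|p2| ^+ 2 <= (e1 - e2) * `|xstar| ^+ 2.
  by rewrite ler_wpM2l ?subr_ge0// lerXn2r ?nnegrE.
move: p1min fx p2sq; rewrite /tikhonov !dot_norm !dotE (dotC _ x2 x1).
by move=> *; lra.
Qed.

Variables (t0 : R) (eps : R -> R).
Hypotheses (eps_gt0 : forall t, t0 <= t -> 0 < eps t)
  (eps_noninc : forall s t, t0 <= s -> s <= t -> eps t <= eps s)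
  (eps_der : forall t, t0 <= t -> derivable_within `[t0, +oo[ eps t).
Variables (xeps : R -> H).
Hypothesis (xeps_min :
  forall t, t0 <= t -> argmin setT (tikhonov f (eps t)) (xeps t)).

(** Dividing by [eps t] rather than [eps s] keeps the constant fixed as [s] approaches [t]. *)
Lemma xeps_lipschitz (t s : R) : t0 <= t -> t0 <= s ->
  `|xeps s - xeps t| <= `|eps s - eps t| * (`|xstar| / eps t).
Proof.
move=> t0t t0s; have et0 := eps_gt0 t0t.
rewrite mulrA ler_pdivlMr// mulrC distrC.
have := tikhonov_argmin_lipschitz dot_norm f_grad f_convex (ltW et0)
  (xeps_min t0t) (xeps_min t0s).
move=> /le_trans; apply; rewrite ler_wpM2l//.
exact: tikhonov_argmin_norm (eps_gt0 t0s) xstar_min (xeps_min t0s).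
Qed.

Lemma xeps_within_continuous (t : R) : t0 <= t ->
  xeps s @[s --> within `[t0, +oo[ (nbhs t)] --> xeps t.
Proof.
move=> t0t; apply/cvgrPdist_le => e e0.
have : `|eps s - eps t| * (`|xstar| / eps t)
    @[s --> within `[t0, +oo[ (nbhs t)] --> `|eps t - eps t| * (`|xstar| / eps t).
  apply: cvgMl; apply: cvg_norm; apply: cvgB; last exact: cvg_cst.
  exact/derivable_within_continuous/eps_der.
rewrite subrr normr0 mul0r => /cvgr_le /(_ e e0).
rewrite !near_withinE; apply: filterS => s /[swap] Ds /(_ Ds) es.
rewrite distrC (le_trans (xeps_lipschitz _ _))//.
by move: Ds; rewrite /= in_itv/= andbT.
Qed.

Variables (x : R -> H) (lambda : R).
Hypotheses (lambda_gt0 : 0 < lambda)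
  (x_der : forall t, t0 <= t -> derivable_within `[t0, +oo[ x t).
Let x' := derive_within `[t0, +oo[ x.
Hypothesis (x'_der : forall t, t0 <= t -> derivable_within `[t0, +oo[ x' t).

Let r (s : R) : R := Num.sqrt (eps s).
Let v (s : R) : H := (lambda * r s) *: (x s - xeps s) + x' s.

(** The difference quotient of [v] between [t] and [s] with [xeps] frozen at its value at [t]. *)
Let w (t s : R) : H := (lambda * diff_quot r t s) *: (x t - xeps t)
  + (lambda * r s) *: diff_quot x t s + diff_quot x' t s.

(* [q] dominates the norm of the difference quotient of [xeps], which need not
   converge: [xeps] contributes to the slope only through this bound. *)
Definition energy_slope (t s : R) : R :=
  let q := - diff_quot eps t s * (`|xstar| / eps t) in
  dot (gradf (x s)) (diff_quot x t s)
  + 2^-1 * (eps s * dot (x s + x t) (diff_quot x t s)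
            + diff_quot eps t s * `|x t| ^+ 2)
  - 2^-1 * (diff_quot eps t s * `|xstar| ^+ 2)
  + (dot (v t) (w t s)
     + lambda * r s * (lambda * r t * `|x t - xeps t| + `|x' t|) * q
     + (s - t) / 2 * (`|w t s| + lambda * r s * q) ^+ 2).

(** The gap increment and the kinetic increment with step [h = s - t] add up to an inequality valid
    for every later [s]; limits are taken only afterwards. *)
Lemma energy_increment (t s : R) : t0 <= t -> t < s ->
  energy t0 lambda f eps xeps x s
  <= energy t0 lambda f eps xeps x t + (s - t) * energy_slope t s.
Proof.
move=> t0t ts; have t0s : t0 <= s := le_trans t0t (ltW ts).
have h0 : 0 < s - t by rewrite subr_gt0.
have dqE (W : normedModType R) (g : R -> W) : g s - g t = (s - t) *: diff_quot g t s.
  by rewrite /diff_quot scalerA divff ?gt_eqF// scale1r.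
have est : eps s - eps t = (s - t) * diff_quot eps t s by exact: dqE.
have rst : r s - r t = (s - t) * diff_quot r t s by exact: dqE.
have xst : x s - x t = (s - t) *: diff_quot x t s by exact: dqE.
have x'st : x' s - x' t = (s - t) *: diff_quot x' t s by exact: dqE.
have gap := tikhonov_gap_increment (x t) (x s) (eps_gt0 t0s)
  (eps_noninc t0t (ltW ts)) (xeps_min t0t) (xeps_min t0s).
have vn : `|v t| <= lambda * r t * `|x t - xeps t| + `|x' t|.
  by rewrite (le_trans (ler_normD _ _))// normrZ ger0_norm// mulr_ge0 ?sqrtr_ge0// ltW.
have yq : `|xeps s - xeps t| <= (s - t) * (- diff_quot eps t s * (`|xstar| / eps t)).
  rewrite (le_trans (xeps_lipschitz t0t t0s))// [leRHS]mulrA mulrN -est opprB.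
  by rewrite distrC ger0_norm// subr_ge0 eps_noninc// ltW.
have lr0 : 0 <= lambda * r s by rewrite mulr_ge0 ?sqrtr_ge0// ltW.
have hw : (s - t) *: w t s = (lambda * (r s - r t)) *: (x t - xeps t)
    + (lambda * r s) *: (x s - x t) + (x' s - x' t).
  rewrite /w xst x'st rst.
  move: (diff_quot x t s) (diff_quot r t s) (diff_quot x' t s) (x t - xeps t).
  move=> dx dr dx' z; rewrite 2!scalerDr !scalerA.
  by congr (_ *: _ + _ *: _ + _); ring.
have := half_sqr_norm_increment dot_norm (w t s) (ltW h0) lr0 vn yq.
have -> : v t + ((s - t) *: w t s - (lambda * r s) *: (xeps s - xeps t)) = v s.
  rewrite hw mulrBr /v; exact: velocity_increment.
have -> : energy t0 lambda f eps xeps x s =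
    tikhonov f (eps s) (x s) - tikhonov f (eps s) (xeps s)
    + 2^-1 * `|v s| ^+ 2 by [].
have -> : energy t0 lambda f eps xeps x t =
    tikhonov f (eps t) (x t) - tikhonov f (eps t) (xeps t)
    + 2^-1 * `|v t| ^+ 2 by [].
move: gap; rewrite xst est !(dotZr _ (s - t)) /energy_slope => gap kin.
lra.
Qed.

Lemma sqrt_right_continuous (t : R) : t0 <= t -> r s @[s --> t^'+] --> r t.
Proof.
move=> t0t; have := sqrt_within_continuous t0t (eps_der t0t).
by apply: cvg_trans; apply: cvg_app; exact: at_right_within_nbhs.
Qed.

Lemma sqrt_right_derivative (t : R) : t0 <= t ->
  diff_quot r t s @[s --> t^'+] -->
  derive_within `[t0, +oo[ eps t / (2 * r t).
Proof.
move=> t0t.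
have rt0 : 0 < r t by rewrite sqrtr_gt0 eps_gt0.
have cr := sqrt_right_continuous t0t.
have -> : derive_within `[t0, +oo[ eps t / (2 * r t) =
    derive_within `[t0, +oo[ eps t * (r t + r t)^-1.
  by congr (_ * _^-1); ring.
have : diff_quot eps t s * (r s + r t)^-1 @[s --> t^'+] -->
    derive_within `[t0, +oo[ eps t * (r t + r t)^-1.
  apply: cvgM; first exact/derive_within_right/eps_der.
  apply: cvgV; first by rewrite gt_eqF// addr_gt0.
  by apply: cvgD => //; exact: cvg_cst.
apply: cvg_trans; apply: near_eq_cvg; near=> s.
have ts : t < s by near: s; exact: nbhs_right_gt.
have t0s := le_trans t0t (ltW ts).
have rs0 : 0 < r s by rewrite sqrtr_gt0 eps_gt0.
rewrite /diff_quot -(sqr_sqrtr (ltW (eps_gt0 t0s))) -(sqr_sqrtr (ltW (eps_gt0 t0t))).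
rewrite -/(r s) -/(r t) subr_sqr /GRing.scale/= -!mulrA divff ?mulr1//.
by rewrite gt_eqF// addr_gt0.
Unshelve. all: by end_near. Qed.

Lemma energy_within_continuous (t : R) : t0 <= t ->
  energy t0 lambda f eps xeps x s @[s --> within `[t0, +oo[ (nbhs t)]
    --> energy t0 lambda f eps xeps x t.
Proof.
move=> t0t.
have ce := derivable_within_continuous t0t (eps_der t0t).
have cx := derivable_within_continuous t0t (x_der t0t).
have cx' := derivable_within_continuous t0t (x'_der t0t).
have cp := xeps_within_continuous t0t.
have cr := sqrt_within_continuous t0t (eps_der t0t).
have c_sqr_norm (g : R -> H) :
    g s @[s --> within `[t0, +oo[ (nbhs t)] --> g t ->
    `|g s| ^+ 2 @[s --> within `[t0, +oo[ (nbhs t)] --> `|g t| ^+ 2.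
  by move=> cg; apply: cvgM; apply: cvg_norm.
have c_tik (g : R -> H) :
    g s @[s --> within `[t0, +oo[ (nbhs t)] --> g t ->
    tikhonov f (eps s) (g s) @[s --> within `[t0, +oo[ (nbhs t)]
      --> tikhonov f (eps t) (g t).
  move=> cg; apply: cvgD.
    by apply: continuous_cvg => //; apply: differentiable_continuous;
      have [] := f_grad (g t).
  by apply: cvgM; [exact: cvgMl|exact: c_sqr_norm].
apply: cvgD; first by apply: cvgB; exact: c_tik.
apply: cvgMr; apply: (c_sqr_norm v); apply: cvgD => //.
by apply: cvgZ; [exact: cvgMr|exact: cvgB].
Qed.

Hypothesis f_C1 : continuous gradf.

Lemma energy_slope_cvg (t : R) : t0 <= t ->
  let e' := derive_within `[t0, +oo[ eps t in
  let q := - e' * (`|xstar| / eps t) in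
  let dv := (lambda * (e' / (2 * r t))) *: (x t - xeps t)
    + (lambda * r t) *: x' t + derive_within `[t0, +oo[ x' t in
  energy_slope t s @[s --> t^'+] -->
    dot (gradf (x t)) (x' t)
    + 2^-1 * (eps t * dot (x t + x t) (x' t) + e' * `|x t| ^+ 2)
    - 2^-1 * (e' * `|xstar| ^+ 2)
    + (dot (v t) dv
       + lambda * r t * (lambda * r t * `|x t - xeps t| + `|x' t|) * q).
Proof.
move=> t0t e' q dv.
have de := derive_within_right t0t (eps_der t0t).
have dx := derive_within_right t0t (x_der t0t).
have dx' := derive_within_right t0t (x'_der t0t).
have dr := sqrt_right_derivative t0t.
have ce := derivable_within_right_continuous t0t (eps_der t0t).
have cx := derivable_within_right_continuous t0t (x_der t0t).
have cr := sqrt_right_continuous t0t.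
have clr : lambda * r s @[s --> t^'+] --> lambda * r t by exact: cvgMr.
have cq : - diff_quot eps t s * (`|xstar| / eps t) @[s --> t^'+] --> q.
  by apply: cvgMl; exact: cvgN.
have cw : w t s @[s --> t^'+] --> dv.
  apply: cvgD => //; apply: cvgD; last exact: cvgZ.
  by apply: cvgZl; exact: cvgMr.
(* The quadratic remainder carries the factor [s - t], hence has limit 0. *)
have crem : (s - t) / 2 *
    (`|w t s| + lambda * r s * (- diff_quot eps t s * (`|xstar| / eps t))) ^+ 2
    @[s --> t^'+] --> (t - t) / 2 * (`|dv| + lambda * r t * q) ^+ 2.
  apply: cvgM.
    apply: cvgMl; apply: cvgB; last exact: cvg_cst.
    by apply: cvg_at_right_filter; exact: cvg_id.
  have cs : `|w t s| + lambda * r s * (- diff_quot eps t s * (`|xstar| / eps t))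
      @[s --> t^'+] --> `|dv| + lambda * r t * q.
    by apply: cvgD; [exact: cvg_norm|exact: cvgM].
  exact: cvgM.
rewrite subrr 2!mul0r in crem.
rewrite -[X in _ + X]addr0.
apply: cvgD; last first.
  apply: cvgD => //; apply: cvgD.
    by apply: cvg_dot => //; exact: cvg_cst.
  by apply: cvgM => //; exact: cvgMl.
apply: cvgB; last by apply: cvgMr; exact: cvgMl.
apply: cvgD.
  by apply: cvg_dot => //; apply: continuous_cvg => //; exact: f_C1.
apply: cvgMr; apply: cvgD; last exact: cvgMl.
apply: cvgM => //; apply: cvg_dot => //; apply: cvgD => //; exact: cvg_cst.
Qed.

Variables (delta a c : R).
Hypotheses (a_gt0 : 0 < a) (c_gt0 : 0 < c)
  (quad_ge0 : 0 <= lambda ^+ 2 - (delta + 1 / c) * lambda + 1)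
  (x_ode : forall t, t0 <= t ->
     derive_within `[t0, +oo[ x' t + (delta * r t) *: x' t
       + gradf (x t) + eps t *: x t = 0).

Lemma eps_derivative_le0 (t : R) : t0 <= t -> derive_within `[t0, +oo[ eps t <= 0.
Proof.
move=> t0t; apply: (cvgr_to_le (derive_within_right t0t (eps_der t0t))).
near=> s.
have ts : t < s by near: s; exact: nbhs_right_gt.
by rewrite /diff_quot pmulr_rle0 ?invr_gt0 ?subr_gt0// subr_le0 eps_noninc// ltW.
Unshelve. all: by end_near. Qed.

(** Everything is rewritten in [r = sqrt eps] and [d], the derivative of [1 / sqrt eps]; the
    differential equation removes the second derivative, and [energy_rate_algebra] bounds the
    rest. *)
Lemma energy_slope_limit (t : R) : t0 <= t ->
  derive_within `[t0, +oo[ (fun s => 1 / Num.sqrt (eps s)) t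
    <= 2 * lambda - delta ->
  derive_within `[t0, +oo[ (fun s => 1 / Num.sqrt (eps s)) t
    <= delta - (a + 1) / a * lambda ->
  exists2 U : R, energy_slope t s @[s --> t^'+] --> U &
    U + mu t0 delta lambda eps t * energy t0 lambda f eps xeps x t
    <= `|xstar| ^+ 2 / 2 *
       ((lambda * c + a) * lambda
        * (derive_within `[t0, +oo[ eps t ^+ 2 / eps t `^ (3 / 2))
        - derive_within `[t0, +oo[ eps t).
Proof.
move=> t0t; rewrite derive_within_inv_sqrt//; last exact: eps_der.
set e' := derive_within _ eps t => growth1 growth2.
eexists; first exact: energy_slope_cvg.
rewrite -/e'.
have e'_le0 : e' <= 0 by exact: eps_derivative_le0.
have et0 := eps_gt0 t0t.
have rt0 : 0 < r t by rewrite sqrtr_gt0.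
have etE : eps t = r t ^+ 2 by rewrite sqr_sqrtr// ltW.
have powE : eps t `^ (3 / 2) = r t ^+ 3.
  rewrite (_ : 3 / 2 = 1 + 2^-1); last by field.
  rewrite powRD ?gt_eqF ?implybT// powRr1 ?ltW// powR12_sqrt ?ltW//.
  by rewrite -/(r t) etE; ring.
set d := - e' / _ in growth1 growth2.
have e'E : e' = - 2 * d * r t ^+ 3.
  by rewrite /d -/(r t) etE; field; rewrite gt_eqF.
have d0 : 0 <= d.
  by rewrite /d divr_ge0 ?oppr_ge0// !mulr_ge0 ?sqrtr_ge0// ltW.
have x''E : derive_within `[t0, +oo[ x' t =
    - (delta * r t) *: x' t - (gradf (x t) + eps t *: x t).
  have /eqP := x_ode t0t; rewrite -!addrA addr_eq0 => /eqP ->.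
  by rewrite !opprD scaleNr.
have W0 : 0 <= tikhonov f (eps t) (x t) - tikhonov f (eps t) (xeps t).
  by rewrite subr_ge0; have [_] := xeps_min t0t; apply.
have strong := tikhonov_strongly_convex dot_norm f_grad f_convex (eps t) (x t) (xeps t).
have rate := energy_rate_algebra (dot (x t - xeps t) (x' t)) `|xstar| a_gt0 c_gt0
  lambda_gt0 rt0 d0 W0 (sqr_ge0 `|x t - xeps t|) (sqr_ge0 `|x' t|) quad_ge0
  growth1 growth2.
rewrite -etE in rate; move: (rate _ strong) => {}rate.
rewrite !sqrtr_sqr !normr_id in rate.
(* This term of the slope has a favourable sign and is discarded. *)
have xx0 : e' * `|x t| ^+ 2 <= 0 by rewrite mulr_le0_ge0.
have e'r : e' / (2 * r t) = - d * r t ^+ 2.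
  by rewrite e'E; field; rewrite gt_eqF.
have muE : mu t0 delta lambda eps t = r t * (d + delta - lambda).
  by rewrite /mu -/e' e'E -/(r t) etE; field; rewrite gt_eqF.
have qE : - e' * (`|xstar| / eps t) = 2 * d * r t * `|xstar|.
  by rewrite e'E etE; field; rewrite gt_eqF.
have sE : e' ^+ 2 / r t ^+ 3 = 4 * d ^+ 2 * r t ^+ 3.
  by rewrite e'E; field; rewrite gt_eqF.
have enE : energy t0 lambda f eps xeps x t =
  tikhonov f (eps t) (x t) - tikhonov f (eps t) (xeps t) + 2^-1 * `|v t| ^+ 2.
  by [].
rewrite powE sE muE qE e'r enE x''E /v.
move: W0 xx0 rate {strong e'r qE sE muE enE powE growth1 growth2 x''E}.
rewrite etE e'E.
move: (tikhonov _ _ _ - _) => W.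
move: (x t) (gradf (x t)) (x' t) (x t - xeps t) => xt g y z.
rewrite (dot_norm (_ + y)) (dot_norm z) (dot_norm y) !dotE.
rewrite (dotC _ g y) (dotC _ xt y) (dotC _ y z).
move=> W0 xx0 rate; lra.
Qed.

End TikhonovEnergy.

(** * A Gronwall inequality for one-sided slopes *)

Section WeightedGronwall.
Context {R : realType}.
Variables (a K : R) (m g E : R -> R).
Hypotheses (cm : {within `[a, +oo[, continuous m})
  (cg : {within `[a, +oo[, continuous g}) (cE : {within `[a, +oo[, continuous E}).

Let weight t := expR (\int[lebesgue_measure]_(s in `[a, t]) m s).

Lemma weight_continuous : {within `[a, +oo[, continuous weight}.
Proof.
apply/subspace_continuousP => t at_; apply: continuous_cvg.
  exact: continuous_expR.
exact: ((subspace_continuousP _ _).1 (halfline_integral_continuous cm)).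
Qed.

Lemma weight_right_derivative (t : R) : a < t ->
  diff_quot weight t s @[s --> t^'+] --> m t * weight t.
Proof.
move=> at_; have [] := halfline_FTC cm at_.
have -> : weight = @expR R \o (fun s => \int[lebesgue_measure]_(r in `[a, s]) m r).
  by [].
move: (fun s => \int[lebesgue_measure]_(r in `[a, s]) m r) => M dM dME.
have dexp : derivable (@expR R) (M t) 1 by exact: derivable_expR.
have dexpM : derivable (@expR R \o M) t 1.
  by apply/derivable1_diffP/differentiable_comp; exact/derivable1_diffP.
have := derivable_right dexpM; rewrite (derive1_comp dM dexp) dME mulrC.
have -> : derive1 (@expR R) (M t) = expR (M t) by rewrite derive1E derive_val.
by [].
Qed.

(** The right Dini derivative of [weight * E - K * G], with [G] the weighted integral, is at most
    [weight * (U + m * E - K * g) <= 0]. *)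
Lemma gronwall_right_dini (t : R) :
  (forall t, a < t -> exists slope U,
     [/\ forall s, t < s -> E s <= E t + (s - t) * slope s,
         slope s @[s --> t^'+] --> U & U + m t * E t <= K * g t]) ->
  a <= t ->
  E t <= K * ((\int[lebesgue_measure]_(s in `[a, t]) (g s * weight s)) / weight t)
         + weight a * E a / weight t.
Proof.
move=> Eslope ae_t.
have w0 s : 0 < weight s by exact: expR_gt0.
have cgw : {within `[a, +oo[, continuous (fun s => g s * weight s)}.
  apply/subspace_continuousP => s as_.
  by apply: cvgM; [exact: ((subspace_continuousP _ _).1 cg)
                  |exact: ((subspace_continuousP _ _).1 weight_continuous)].
pose G s := \int[lebesgue_measure]_(r in `[a, s]) (g r * weight r).
pose F s := weight s * E s - K * G s.
have : F t <= F a.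
  apply: nonincreasing_right_dini => //.
    apply: (@continuous_subspaceW _ _ _ `[a, +oo[).
      by move=> s /=; rewrite !in_itv/= => /andP[->].
    apply/subspace_continuousP => s as_; apply: cvgB.
      by apply: cvgM; [exact: ((subspace_continuousP _ _).1 weight_continuous)
                      |exact: ((subspace_continuousP _ _).1 cE)].
    apply: cvgMr.
    exact: ((subspace_continuousP _ _).1 (halfline_integral_continuous cgw)).
  move=> s as_ _ e e0.
  have [slope [U [Es slopeU Ule]]] := Eslope s as_.
  have [dG dGE] := halfline_FTC cgw as_.
  have dw := weight_right_derivative as_.
  have dG' := derivable_right dG.
  (* A discrete product rule: [E] is not differentiable, so its increment is replaced by the bound
     [slope], multiplied by [weight r] and not [weight s]. *)
  have Z : diff_quot weight s r * E s + weight r * slope r - K * diff_quot G s r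
      @[r --> s^'+] --> m s * weight s * E s + weight s * U - K * (g s * weight s).
    apply: cvgB; last by apply: cvgMr; rewrite -dGE.
    apply: cvgD; first exact: cvgMl.
    apply: cvgM => //; apply: cvg_at_right_filter.
    exact: halfline_continuous_at weight_continuous _ as_.
  have Zle : m s * weight s * E s + weight s * U - K * (g s * weight s) < e.
    have := ler_wpM2l (ltW (w0 s)) Ule; lra.
  near=> r.
  have sr : s < r by near: r; exact: nbhs_right_gt.
  have : diff_quot weight s r * E s + weight r * slope r - K * diff_quot G s r <= e.
    by near: r; exact: (cvgr_le _ Z).
  have rs0 : 0 < r - s by rewrite subr_gt0.
  move=> /(ler_wpM2l (ltW rs0)).
  have wE : weight r = weight s + (r - s) * diff_quot weight s r.
    by rewrite /diff_quot /GRing.scale/= mulrA divff ?mul1r ?subrKC// gt_eqF.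
  have GE : G r = G s + (r - s) * diff_quot G s r.
    by rewrite /diff_quot /GRing.scale/= mulrA divff ?mul1r ?subrKC// gt_eqF.
  have := ler_wpM2l (ltW (w0 r)) (Es r sr); rewrite /F.
  move: (diff_quot weight s r) (diff_quot G s r) wE GE => dw' dG'' -> ->.
  by move=> ? ?; lra.
(* At [a] the integral is over a single point and vanishes. *)
rewrite /F /G set_itv1 Rintegral_set1 mulr0 subr0 => Fta.
rewrite mulrA -mulrDl ler_pdivlMr//.
by rewrite -lerBlDl mulrC.
Unshelve. all: by end_near. Qed.

End WeightedGronwall.

(** * The energy estimate *)

Theorem theorem4 (R : realType) (H : completeNormedModType R)
  (dot : {dot H for idfun}) (dot_norm : induces_norm dot)
  (f : H -> R) (gradf : H -> H)
  (f_convex : convex_function setT f)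
  (f_grad : is_gradient dot f gradf)
  (f_C1 : continuous gradf)
  (gradf_lip : forall B : set H, bounded_set B -> [lipschitz gradf y | y in B])
  (S_neq0 : argmin setT f !=set0)
  (xstar : H) (xstar_min : argmin (argmin setT f) (fun y => `|y|) xstar)
  (t0 : R) (eps : R -> R)
  (eps_gt0 : forall t, t0 <= t -> 0 < eps t)
  (eps_noninc : forall s t, t0 <= s -> s <= t -> eps t <= eps s)
  (eps_C1 : C1_within `[t0, +oo[%classic eps)
  (eps_lim : eps t @[t --> +oo] --> (0 : R))
  (delta : R) (delta_gt0 : 0 < delta)
  (xeps : R -> H)
  (xeps_min : forall t, t0 <= t -> argmin setT (tikhonov f (eps t)) = [set xeps t])
  (x : R -> H) (x_sol : trajectory t0 delta eps gradf x)
  (a c t1 lambda : R) (a_gt1 : 1 < a) (c_gt1 : 1 < c) (t0_le_t1 : t0 <= t1)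
  (lambda_small : delta <= 2 - 1 / c ->
     delta / 2 < lambda /\ lambda < a / (a + 1) * delta)
  (lambda_large : 2 - 1 / c < delta ->
     2^-1 * (delta + 1 / c + Num.sqrt ((delta + 1 / c) ^+ 2 - 4)) < lambda
     /\ lambda < a / (a + 1) * delta)
  (eps_growth : forall t, t1 <= t ->
     derive_within `[t0, +oo[%classic (fun s => 1 / Num.sqrt (eps s)) t
     <= Num.min (2 * lambda - delta) (delta - (a + 1) / a * lambda)) :
  let eps' := derive_within `[t0, +oo[%classic eps in
  let E := energy t0 lambda f eps xeps x in
  let gamma := gamma t0 t1 delta lambda eps in
  forall t, t1 <= t ->
    E t <= `|xstar| ^+ 2 / 2 *
             ((\int[lebesgue_measure]_(s in `[t1, t])
                 (((lambda * c + a) * lambda * (eps' s ^+ 2 / eps s `^ (3 / 2))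
                   - eps' s) * gamma s)) / gamma t)
           + gamma t1 * E t1 / gamma t.
Proof.
move=> eps' E gamma0 t t1t.
have inD s : t0 <= s -> `[t0, +oo[%classic s by rewrite /= in_itv/= andbT.
have [eps_der0 ceps'] := eps_C1.
have eps_der s : t0 <= s -> derivable_within `[t0, +oo[ eps s.
  by move=> /inD; exact: eps_der0.
have [[[x_der0 _] [x'_der0 _]] x_ode] := x_sol.
have x_der s : t0 <= s -> derivable_within `[t0, +oo[ x s.
  by move=> /inD; exact: x_der0.
have x'_der s : t0 <= s ->
    derivable_within `[t0, +oo[ (derive_within `[t0, +oo[ x) s.
  by move=> /inD; exact: x'_der0.
have xeps_argmin s : t0 <= s -> argmin setT (tikhonov f (eps s)) (xeps s).
  by move=> /xeps_min ->.
have [xstar_argmin _] := xstar_min.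
have [lambda_gt0 quad_ge0] := damping_quadratic_ge0 delta_gt0 c_gt1
  (fun h => (lambda_small h).1) (fun h => (lambda_large h).1).
have a_gt0 : 0 < a := lt_trans ltr01 a_gt1.
have c_gt0 : 0 < c := lt_trans ltr01 c_gt1.
(* Derivatives are taken within the half-line from [t0], the Gronwall argument runs on the one from
   [t1]; continuity is restricted from the former to the latter. *)
have sub_D : `[t1, +oo[ `<=` (`[t0, +oo[%classic : set R).
  by move=> s /=; rewrite !in_itv/= !andbT; exact: le_trans.
have toD s : `[t0, +oo[%classic s -> t0 <= s by rewrite /= in_itv/= andbT.
have ceps s : t0 <= s -> eps r @[r --> within `[t0, +oo[ (nbhs s)] --> eps s.
  by move=> t0s; exact/derivable_within_continuous/eps_der.
have ceps'D s : t0 <= s -> eps' r @[r --> within `[t0, +oo[ (nbhs s)] --> eps' s.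
  by move=> t0s; apply: ((subspace_continuousP _ _).1 ceps'); exact: inD.
apply: (@gronwall_right_dini _ t1 (`|xstar| ^+ 2 / 2) (mu t0 delta lambda eps)
  (fun s => (lambda * c + a) * lambda * (eps' s ^+ 2 / eps s `^ (3 / 2)) - eps' s)
  E) => //.
- apply: (continuous_subspaceW sub_D); apply/subspace_continuousP => s /toD t0s.
  apply: cvgD; last first.
    by apply: cvgMr; exact/sqrt_within_continuous/eps_der.
  apply: cvgM; first by apply: cvgN; exact: ceps'D.
  apply: cvgV; first by rewrite mulf_neq0// gt_eqF// eps_gt0.
  by apply: cvgMr; exact: ceps.
- apply: (continuous_subspaceW sub_D); apply/subspace_continuousP => s /toD t0s.
  apply: cvgB; last exact: ceps'D.
  apply: cvgMr; apply: cvgM; first by apply: cvgM; exact: ceps'D.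
  apply: cvgV; first by rewrite gt_eqF// powR_gt0// eps_gt0.
  have cpow : {for eps s, continuous (fun y : R => y `^ (3 / 2))}.
    apply: differentiable_continuous; apply/derivable1_diffP.
    by apply: derivable_powR; rewrite in_itv/= andbT eps_gt0.
  exact: (cvg_comp eps (fun y : R => y `^ (3 / 2)) (ceps _ t0s) cpow).
- apply: (continuous_subspaceW sub_D); apply/subspace_continuousP => s /toD t0s.
  exact: (energy_within_continuous dot_norm f_convex f_grad xstar_argmin).
- move=> s t1s; have t0s : t0 <= s := le_trans t0_le_t1 (ltW t1s).
  have := eps_growth s (ltW t1s); rewrite le_min => /andP[growth1 growth2].
  have [U slopeU Ule] := energy_slope_limit dot_norm f_convex f_grad xstar
    eps_gt0 eps_noninc eps_der xeps_argmin lambda_gt0 x_der x'_der f_C1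
    a_gt0 c_gt0 quad_ge0 x_ode t0s growth1 growth2.
  exists (energy_slope dot gradf xstar t0 eps xeps x lambda s), U; split => //.
  by move=> r sr; exact: (energy_increment dot_norm f_convex f_grad).
Qed.
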